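(* Let $K_1\in\mathbb{C}^{n_1\times n_1}$ be the differential matrix with quasi-periodic boundary condition $$K_1=\frac{1}{\delta_x}\begin{bmatrix}-1&1&&&\\&-1&1&&\\&&\ddots&\ddots&\\&&&-1&1\\ e^{\imath2\pi\mathbf{k}\cdot\mathbf{a}_1}&&&&-1\end{bmatrix}.$$ Then the $i$-th eigenvalue of $K_1$ is $$\lambda_i=\frac{e^{\theta_i}-1}{\delta_x}\quad\text{with}\quad\theta_i=\frac{\imath2\pi(i+\mathbf{k}\cdot\mathbf{a}_1)}{n_1},$$ and the corresponding $i$-th eigenvector is $$\mathbf{x}_i=\begin{bmatrix}1&e^{\theta_i}&\cdots&e^{(n_1-1)\theta_i}\end{bmatrix}^\top,$$ for $i=1,\dots,n_1$.
   Context: $\imath=\sqrt{-1}$ (distinct from the integer index $i$); $n_1$ is a positive integer; $\delta_x>0$ is the mesh size $\|\mathbf{a}_1\|/n_1$; $\mathbf{a}_1\in\mathbb{R}^3$ is a nonzero lattice vector and $\mathbf{k}\in\mathbb{R}^3$ ($2\pi\mathbf{k}$ is the Bloch wave vector). Equivalently, $(K_1v)_s=\delta_x^{-1}(v_{s+1}-v_s)$ for $s=1,\dots,n_1$, with $v_{n_1+1}:=e^{\imath2\pi\mathbf{k}\cdot\mathbf{a}_1}v_1$. *)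

(* Defs.v *)
From HB Require Import structures.
From mathcomp Require Import all_boot all_order all_algebra.
From mathcomp Require Import complex.
From mathcomp Require Import all_classical all_reals all_analysis.

Set Implicit Arguments.
Unset Strict Implicit.
Unset Printing Implicit Defensive.

Import Order.TTheory GRing.Theory Num.Theory.

Local Open Scope ring_scope.
Local Open Scope complex_scope.

(* MathComp-Analysis has no complex exponential; this is
   e^(a + b i) = e^a (cos b + i sin b). *)
Definition cexp (R : realType) (z : R[i]) : R[i] :=
  (expR (complex.Re z))%:C * (cos (complex.Im z) +i* sin (complex.Im z)).

Definition dot3 (R : realType) (u v : 'rV[R]_3) : R := (u *m v^T) 0 0.

(* The Euclidean norm: MathComp-Analysis' `|u| on matrices is the sup norm. *)
Definition norm3 (R : realType) (u : 'rV[R]_3) : R := Num.sqrt (dot3 u u).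

Definition mesh_size (R : realType) (n : nat) (a : 'rV[R]_3) : R :=
  norm3 a / n%:R.

Definition bloch_phase (R : realType) (k a : 'rV[R]_3) : R[i] :=
  cexp ('i%C * (2 * pi * dot3 k a)%:C).

(* Rows and columns are 0-based. The three contributions are added, so for
   n = 1 the only entry is (bloch_phase k a - 1) / mesh_size 1 a, in accordance
   with (K v)_s = (v_(s+1) - v_s) / delta and v_(n+1) = bloch_phase k a * v_1. *)
Definition diff_mx (R : realType) (n : nat) (k a : 'rV[R]_3) : 'M[R[i]]_n :=
  ((mesh_size n a)%:C)^-1 *:
  \matrix_(s, t)
    ((t == s.+1 :> nat)%:R - (t == s)%:R
     + bloch_phase k a * ((s.+1 == n) && (t == 0 :> nat))%:R).

Definition theta (R : realType) (n : nat) (k a : 'rV[R]_3) (i : nat) : R[i] :=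
  'i%C * (2 * pi * (i%:R + dot3 k a))%:C / n%:R.

Definition lambda (R : realType) (n : nat) (k a : 'rV[R]_3) (i : nat) : R[i] :=
  (cexp (theta n k a i) - 1) / (mesh_size n a)%:C.

Definition bloch_vec (R : realType) (n : nat) (k a : 'rV[R]_3) (i : nat) :
    'cV[R[i]]_n :=
  \col_(s < n) cexp (s%:R * theta n k a i).

(* Column eigenvectors; the library's [eigenspace] is about row vectors. *)
Definition eigenpair (F : fieldType) (n : nat) (A : 'M[F]_n) (l : F)
    (x : 'cV[F]_n) : Prop :=
  x != 0 /\ A *m x = l *: x.

(* Main.v *)
Require Import Defs.
From mathcomp Require Import all_boot all_order all_algebra.
From mathcomp Require Import complex.
From mathcomp Require Import all_classical all_reals all_analysis.
From mathcomp Require Import ring lra.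

Set Implicit Arguments.
Unset Strict Implicit.
Unset Printing Implicit Defensive.

Import Order.TTheory GRing.Theory Num.Theory.

Local Open Scope ring_scope.

(** A geometric sequence [1, w, w^2, ...] is multiplied by [w - 1] under the
    forward difference. Its first [n] terms therefore form an eigenvector of the
    difference matrix, with eigenvalue [(w - 1) / delta_x], as soon as the
    sequence satisfies the boundary condition, that is, as soon as [w ^+ n] is
    the Bloch phase. The numbers [w = cexp (theta_i)] satisfy this equation
    ([cexp_theta_expn]), and the action of the matrix on such sequences is
    [diff_mxE]; together they give [bloch_vec_eigenpair].

    The factorization of the characteristic polynomial says that these are all
    the eigenvalues, each of multiplicity one. For [i = 1, ..., n] the angles lie
    within less than one full turn of each other, so the [n] values
    [cexp (theta_i)] are distinct ([cexp_theta_inj]). Dividing by the mesh size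
    keeps them distinct, since it is nonzero ([mesh_size_neq0]). The
    characteristic polynomial is monic of degree [n] and has these [n] distinct
    roots, so it is the product of the linear factors
    ([char_poly_uniq_roots]). *)

Lemma cexpD (R : realType) (x y : R[i]) : cexp (x + y) = cexp x * cexp y.
Proof.
case: x y => [a b] [c d]; rewrite /cexp /= expRD cosD sinD.
simpc; congr (complex.Complex _ _); ring.
Qed.

Lemma cexp0 (R : realType) : cexp (0 : R[i]) = 1.
Proof. by rewrite /cexp /= expR0 cos0 sin0; simpc. Qed.

Lemma cexpMn (R : realType) (n : nat) (x : R[i]) :
  cexp (n%:R * x) = cexp x ^+ n.
Proof.
elim: n => [|n IHn]; first by rewrite mul0r cexp0 expr0.
by rewrite -natr1 mulrDl mul1r cexpD IHn exprSr.
Qed.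

Lemma cexp_iE (R : realType) (t : R) :
  cexp ('i%C * t%:C%C) = (cos t +i* sin t)%C.
Proof. by rewrite /cexp /=; simpc; rewrite /= expR0 !mul1r. Qed.

Lemma cexp_2pi (R : realType) (i : nat) :
  cexp ('i%C * (2 * pi * i%:R)%:C%C) = 1 :> R[i].
Proof.
have -> : 'i%C * (2 * pi * i%:R)%:C%C = i%:R * ('i%C * (pi *+ 2)%:C%C) :> R[i].
  rewrite -mulr_natl !rmorphM /= !rmorph_nat; ring.
by rewrite cexpMn cexp_iE cos2pi sin2pi expr1n.
Qed.

Lemma cos_eq1 (R : realType) (t : R) : 0 <= t < 2 * pi -> cos t = 1 -> t = 0.
Proof.
move=> /andP[t_ge0 t_lt] cos_t; apply/eqP; rewrite eq_le t_ge0 andbT leNgt.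
apply/negP => t_gt0.
have : 0 < sin (t / 2) by apply: sin_gt0_pi; lra.
(* The half-angle identity [cos t = 1 - 2 sin (t / 2) ^ 2] leaves no room for
   [cos t = 1]. *)
have := cosD (t / 2) (t / 2); have := cos2Dsin2 (t / 2).
rewrite -splitr cos_t; nra.
Qed.

(** The complex exponential is injective on a segment of the imaginary axis
    shorter than its period: equal values make [cos (s - t)] equal to 1. *)
Lemma cexp_i_inj (R : realType) (s t : R) :
  `|s - t| < 2 * pi -> cexp ('i%C * s%:C%C) = cexp ('i%C * t%:C%C) -> s = t.
Proof.
rewrite !cexp_iE => dist_lt [cosE sinE]; apply/eqP; rewrite -subr_eq0 -normr_eq0.
apply/eqP/cos_eq1; first by rewrite normr_ge0.
have -> : cos `|s - t| = cos (s - t) by case: ler0P; rewrite ?cosN.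
by rewrite cosB cosE sinE -!expr2 cos2Dsin2.
Qed.

Lemma thetaE (R : realType) (n : nat) (k a : 'rV[R]_3) (i : nat) :
  theta n k a i = 'i%C * (2 * pi * (i%:R + dot3 k a) / n%:R)%:C%C.
Proof.
rewrite /theta -mulrA; congr (_ * _).
by rewrite [RHS](rmorphM (real_complex R)) [in RHS]fmorphV rmorph_nat.
Qed.

(** The quasi-periodic boundary condition: the ratio of the geometric sequence
    is an [n]-th root of the Bloch phase. The integer [i] only contributes the
    factor [cexp (2 pi i)], which is 1. *)
Lemma cexp_theta_expn (R : realType) (n : nat) (k a : 'rV[R]_3) (i : nat) :
  (0 < n)%N -> cexp (theta n k a i) ^+ n = bloch_phase k a.
Proof.
move=> n_gt0; rewrite -cexpMn /theta mulrC divfK ?pnatr_eq0 -?lt0n //.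
by rewrite mulrDr rmorphD mulrDr cexpD cexp_2pi mul1r.
Qed.

(** The [n] roots are distinct, because two of the angles differ by
    [2 pi (i - j) / n], which is less than a full turn in absolute value. *)
Lemma cexp_theta_inj (R : realType) (n : nat) (k a : 'rV[R]_3) (i j : nat) :
  (1 <= i <= n)%N -> (1 <= j <= n)%N ->
  cexp (theta n k a i) = cexp (theta n k a j) -> i = j.
Proof.
move=> /andP[i_ge1 i_le] /andP[j_ge1 j_le]; rewrite !thetaE => /cexp_i_inj inj.
have n_gt0 : 0 < n%:R :> R by rewrite ltr0n (leq_trans i_ge1).
have pi2_gt0 : 0 < 2 * pi :> R by have := pi_gt0 R; lra.
apply/eqP; rewrite -(eqr_nat R); apply/eqP.
apply: (addIr (dot3 k a)); apply: (mulfI (lt0r_neq0 pi2_gt0)).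
apply: (divIf (lt0r_neq0 n_gt0)); apply: inj.
rewrite -mulrBl -mulrBr opprD addrACA subrr addr0 -mulrA normrM gtr0_norm //.
rewrite gtr_pMr // normrM normfV (gtr0_norm n_gt0) ltr_pdivrMr // mul1r.
move: i_ge1 i_le j_ge1 j_le; rewrite -!(ler_nat R) ltr_norml.
by move=> *; apply/andP; split; lra.
Qed.

Lemma mesh_size_neq0 (R : realType) (n : nat) (a : 'rV[R]_3) :
  (0 < n)%N -> a != 0 -> mesh_size n a != 0.
Proof.
move=> n_gt0 a_neq0; rewrite /mesh_size mulf_neq0 ?invr_eq0 ?pnatr_eq0 -?lt0n//.
rewrite sqrtr_eq0 -ltNge /dot3 mxE.
have sq i : 0 <= a 0 i * a^T i 0 by rewrite mxE -expr2 sqr_ge0.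
rewrite lt0r sumr_ge0 // andbT; apply: contraNneq a_neq0 => /eqP.
rewrite psumr_eq0 // => /allP sum0; apply/eqP/rowP => i; rewrite mxE.
have := sum0 i; rewrite mem_index_enum mxE -expr2 sqrf_eq0 => /(_ isT) /eqP.
exact.
Qed.

(** The matrix acts as a forward difference quotient on the first [n] terms of
    an infinite sequence, provided the next term obeys the quasi-periodic
    condition. Working with sequences indexed by [nat] removes the special role
    of the last row. *)
Lemma diff_mxE (R : realType) (n : nat) (k a : 'rV[R]_3) (v : nat -> R[i]) :
  (0 < n)%N -> v n = bloch_phase k a * v 0%N ->
  diff_mx n k a *m (\col_(s < n) v s) =
    \col_(s < n) ((v s.+1 - v s) / (mesh_size n a)%:C%C).
Proof.
move=> n_gt0 vn; rewrite /diff_mx -scalemxAl; apply/colP => s.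
rewrite !mxE [RHS]mulrC; congr (_ * _).
under eq_bigr => t _ do rewrite !mxE 2!mulrDl mulNr -mulrA.
have sum_pick (P : pred 'I_n) (j : 'I_n) : P =1 pred1 j ->
    \sum_t (P t)%:R * v t = v j.
  move=> PE; rewrite (bigD1 j) //= PE /= eqxx mul1r big1 ?addr0 // => t /negbTE tj.
  by rewrite PE /= tj mul0r.
rewrite !big_split /= sumrN (sum_pick (fun t => t == s) s) // -mulr_sumr.
have [sn | s_neq] := eqVneq s.+1 n.
(* In the last row the superdiagonal is empty and the corner entry takes over. *)
- rewrite (sum_pick (fun t => t == 0 :> nat) (Ordinal n_gt0)) //= -vn.
  rewrite big1 ?add0r; first by rewrite sn addrC.
  by move=> t _; rewrite sn (ltn_eqF (ltn_ord t)) mul0r.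
- have s_lt : (s.+1 < n)%N by rewrite ltn_neqAle s_neq ltn_ord.
  rewrite (sum_pick (fun t => t == s.+1 :> nat) (Ordinal s_lt)) //=.
  by rewrite [X in _ * X]big1 ?mulr0 ?addr0 // => t _; rewrite mul0r.
Qed.

Lemma bloch_vec_eigenpair (R : realType) (n : nat) (k a : 'rV[R]_3) (i : nat) :
  (0 < n)%N ->
  eigenpair (diff_mx n k a) (lambda n k a i) (bloch_vec n k a i).
Proof.
move=> n_gt0; split.
  apply/eqP => /colP /(_ (Ordinal n_gt0)); rewrite !mxE mul0r cexp0 => /eqP.
  by rewrite oner_eq0.
rewrite (@diff_mxE _ _ _ _ (fun s => cexp (s%:R * theta n k a i))) //.
  apply/colP => s; rewrite !mxE !cexpMn /lambda exprS; ring.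
by rewrite cexpMn cexp_theta_expn // mul0r cexp0 mulr1.
Qed.

Lemma char_poly_trmx (F : comNzRingType) (n : nat) (A : 'M[F]_n) :
  char_poly A^T = char_poly A.
Proof.
rewrite /char_poly -det_tr; congr (\det _).
by apply/matrixP => s t; rewrite !mxE eq_sym.
Qed.

(** Transposition is needed because [eigenvalue] refers to row vectors, whereas
    an eigenpair has a column vector. *)
Lemma eigenpair_root (F : fieldType) (n : nat) (A : 'M[F]_n) (l : F)
    (x : 'cV[F]_n) : eigenpair A l x -> root (char_poly A) l.
Proof.
case=> x_neq0 Ax; rewrite -char_poly_trmx -eigenvalue_root_char.
by apply/eigenvalueP; exists x^T; rewrite ?trmx_eq0 // -trmx_mul Ax linearZ.
Qed.

(** A monic polynomial of degree [n] with [n] distinct roots is the product of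
    the corresponding linear factors. *)
Lemma char_poly_uniq_roots (F : fieldType) (n : nat) (A : 'M[F]_n)
    (rs : seq F) :
  size rs = n -> uniq rs -> all (root (char_poly A)) rs ->
  char_poly A = \prod_(l <- rs) ('X - l%:P).
Proof.
move=> size_rs rs_uniq rs_roots.
rewrite [LHS](all_roots_prod_XsubC _ rs_roots) ?uniq_rootsE //.
  by rewrite (monicP (char_poly_monic A)) scale1r.
by rewrite size_char_poly size_rs.
Qed.

Theorem theorem4p1 (R : realType) (n1 : nat) (k a1 : 'rV[R]_3)
    (n1_gt0 : (0 < n1)%N) (a1_neq0 : a1 != 0) :
  (forall i : nat, (1 <= i <= n1)%N ->
     eigenpair (diff_mx n1 k a1) (lambda n1 k a1 i) (bloch_vec n1 k a1 i)) /\
  char_poly (diff_mx n1 k a1) =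
    \prod_(1 <= i < n1.+1) ('X - (lambda n1 k a1 i)%:P).
Proof.
split=> [i _|]; first exact: bloch_vec_eigenpair.
rewrite -(big_map (lambda n1 k a1) xpredT (fun l => 'X - l%:P)).
apply: char_poly_uniq_roots.
- by rewrite size_map size_iota subn1.
- rewrite map_inj_in_uniq ?iota_uniq // => i j.
  rewrite !mem_index_iota !ltnS => i_in j_in.
  have dx_neq0 : ((mesh_size n1 a1)%:C%C)^-1 != 0.
    by rewrite invr_eq0 fmorph_eq0 mesh_size_neq0.
  by move=> /(mulIf dx_neq0) /addIr; apply: cexp_theta_inj.
- apply/allP => _ /mapP[i _ ->].
  exact: eigenpair_root (bloch_vec_eigenpair k a1 i n1_gt0).
Qed.
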